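(* Let $K$ be a finite simplicial complex, $\mathcal{V}$ a multivector field on $K$, $N\subseteq K$ closed, $S$ an invariant set isolated by $N$ under $\mathcal{V}$, $(P,E)$ an index pair in $N$ for $S$ under $\mathcal{V}$, and $\delta\ge 0$ an integer. Let $R$ be the output of the algorithm $\mathtt{findR}(S,P,E,\mathcal{V},\delta)$ (described in the context). Then $(P,E\setminus R)$ is an index pair for $S$ in $N$.
   Context: $K$ is identified with its finite set of simplices; $\sigma\le\sigma'$ means that $\sigma$ is a (not necessarily proper) face of $\sigma'$. For $A\subseteq K$, $\mathrm{cl}(A)=\{\tau\in K : \tau\le\sigma \text{ for some }\sigma\in A\}$, $\mathrm{cl}(\sigma)=\mathrm{cl}(\{\sigma\})$, $A$ is closed if $\mathrm{cl}(A)=A$, and $\mathrm{mo}(A)=\mathrm{cl}(A)\setminus A$. A multivector is a set $A\subseteq K$ such that $\sigma\le\tau\le\sigma'$ with $\sigma,\sigma'\in A$, $\tau\in K$ implies $\tau\in A$. A multivector field $\mathcal{V}$ on $K$ is a partition of $K$ into multivectors; $[\sigma]=[\sigma]_{\mathcal{V}}$ is the element of $\mathcal{V}$ containing $\sigma$. A multivector $V$ is critical if the relative simplicial homology $H_p(\mathrm{cl}(V),\mathrm{mo}(V))\neq 0$ for some $p$, and regular otherwise. $F_{\mathcal{V}}(\sigma)=\mathrm{cl}(\sigma)\cup[\sigma]_{\mathcal{V}}$ and $F_{\mathcal{V}}(A)=\bigcup_{\sigma\in A}F_{\mathcal{V}}(\sigma)$. A path (under $\mathcal{V}$) is a map $\rho:\mathbb{Z}\cap[a,b]\to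 K$ with $\rho(i)\in F_{\mathcal{V}}(\rho(i-1))$ for all integers $a<i\le b$. A solution is a map $\rho:\mathbb{Z}\to K$ with $\rho(i)\in F_{\mathcal{V}}(\rho(i-1))$ for all $i$. It is essential if for each $i$ with $[\rho(i)]$ regular there are $i^-<i<i^+$ with $[\rho(i^-)]\ne[\rho(i)]\ne[\rho(i^+)]$. $\mathrm{Inv}(A)$ is the set of $\sigma\in A$ for which there is an essential solution $\rho$ with $\rho(\mathbb{Z})\subseteq A$ and $\rho(0)=\sigma$. $A$ is invariant if $\mathrm{Inv}(A)=A$. An invariant set $S\subseteq N$, $N$ closed, is isolated by $N$ if every path with values in $N$ and both endpoints in $S$ has all its values in $S$. Index pair in $N$: a pair of closed sets $E\subseteq P\subseteq N$ is an index pair for $S$ in $N$ if (1) $F_{\mathcal{V}}(P)\cap N\subseteq P$; (2) $F_{\mathcal{V}}(E)\cap N\subseteq E$; (3) $F_{\mathcal{V}}(P\setminus E)\subseteq N$; (4) $S=\mathrm{Inv}(P\setminus E)$. $\delta$-collar $C_\delta(S)$: $C_0(S)=\mathrm{cl}(S)$; for $\delta>0$, $C_\delta(S)$ consists of the simplices of $C_{\delta-1}(S)$ together with all simplices $\tau$ that are a face of some $\sigma\in K$ having a face $\tau'\in C_{\delta-1}(S)$. Algorithm $\mathtt{findR}(S,P,E,\mathcal{V},\delta)$: Initialize $R=\emptyset$ and a queue $vec$ containing the multivectors $[\sigma]\in\mathcal{V}$ with $[\sigma]\subseteq E\cap C_\delta(S)$, $[\sigma]\cap\partial(E)\ne\emptyset$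 and $[\sigma]\cap\partial(P)=\emptyset$. Here $\partial(E),\partial(P)\subseteq K$ are the boundaries of $E$ and $P$; the claim may be read with these as any two fixed subsets of $K$. While the queue is nonempty: pop a multivector $[\sigma]$ from it; if $(E\setminus R)\setminus[\sigma]$ is closed, $[\sigma]\subseteq E\setminus R$, and $[\sigma]$ is regular, then replace $R$ by $R\cup[\sigma]$ and append to the queue all multivectors $[\tau]$ with $\tau\in\mathrm{mo}([\sigma])$ and $[\tau]\subseteq C_\delta(S)$. When the queue is empty, output $R$. *)

(* Defs.v *)
From HB Require Import structures.
From mathcomp Require Import all_boot all_order all_algebra.
From mathcomp Require Import ring_quotient.
From mathcomp Require Import boolp.

Set Implicit Arguments.
Unset Strict Implicit.
Unset Printing Implicit Defensive.

Import Order.TTheory GRing.Theory Num.Theory.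
Local Open Scope ring_scope.

Record simplicialComplex (T : finType) := SimplicialComplex {
  simplices : {set {set T}};
  simplices_neq0 : set0 \notin simplices;
  simplices_face : forall s t : {set T},
    s \in simplices -> t \subset s -> t != set0 -> t \in simplices
}.

Definition simplex (T : finType) (K : simplicialComplex T) : Type :=
  {s : {set T} | s \in simplices K}.

HB.instance Definition _ (T : finType) (K : simplicialComplex T) :=
  SubFinite.on (simplex K).

Section Complex.
Variables (T : finType) (K : simplicialComplex T).
Implicit Types (s t : simplex K) (A L : {set simplex K}).

Definition face t s : bool := val t \subset val s.

Definition cl A : {set simplex K} := [set t | [exists s in A, face t s]].

Definition is_closed A : bool := cl A == A.

Definition mo A : {set simplex K} := cl A :\: A.

End Complex.

(* Relative simplicial homology of a pair L0 \subset L of closed subsets of K,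
   with coefficients in an arbitrary abelian group G, presented as
     H_p(L, L0) = {c in C_p(L) | bd c in C_(p-1)(L0)}
                  / (bd C_(p+1)(L) + C_p(L0)).
   Simplices are oriented by the fixed enumeration of the vertex type.  The empty
   set is not a simplex, so the boundary of a 0-chain is 0 (homology is not
   reduced). *)
Section Homology.
Variables (T : finType) (K : simplicialComplex T) (G : zmodType).
Local Notation chain := {ffun simplex K -> G}.
Implicit Types (L : {set simplex K}) (c d e : chain).

Definition vertex_pos (s : {set T}) (v : T) : nat :=
  #|[set w in s | (enum_rank w < enum_rank v)%N]|.

Definition bd c : chain :=
  [ffun t => \sum_(s : simplex K)
               \sum_(v in val s | val s :\ v == val t)
                 c s *~ ((-1) ^+ vertex_pos (val s) v)].

Definition supported c L : bool := [forall s, (c s != 0) ==> (s \in L)].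

Definition chain_in L (p : nat) c : bool :=
  supported c [set s in L | #|val s| == p.+1].

Lemma bd_is_zmod_morphism : zmod_morphism bd.
Proof.
move=> c d; apply/ffunP => t; rewrite !ffunE -sumrB; apply: eq_bigr => s _.
by rewrite -sumrB; apply: eq_bigr => v _; rewrite !ffunE mulrzBl.
Qed.

HB.instance Definition _ :=
  GRing.isZmodMorphism.Build chain chain bd bd_is_zmod_morphism.

Lemma supported0 L : supported 0 L.
Proof. by apply/forallP => s; rewrite ffunE eqxx. Qed.

Lemma supportedB c d L :
  supported c L -> supported d L -> supported (c - d) L.
Proof.
move=> /forallP cL /forallP dL; apply/forallP => s; apply/implyP.
apply: contraNT => sL; rewrite !ffunE.
have /eqP-> : c s == 0 by apply: contraNT sL => /(implyP (cL s)).
have /eqP-> : d s == 0 by apply: contraNT sL => /(implyP (dL s)).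
by rewrite subrr.
Qed.

Section Pair.
Variables (L L0 : {set simplex K}) (p : nat).

Definition rel_cycle : pred chain :=
  [pred c | chain_in L p c && supported (bd c) L0].

Lemma rel_cycle_closed : zmod_closed rel_cycle.
Proof.
split=> [|c d]; first by rewrite inE /chain_in raddf0 !supported0.
rewrite !inE /chain_in => /andP[cL bcL0] /andP[dL bdL0].
by rewrite raddfB !supportedB.
Qed.

HB.instance Definition _ := GRing.isZmodClosed.Build chain rel_cycle
  rel_cycle_closed.

Record relZ := RelZ { relZ_val :> chain; relZ_valP : relZ_val \in rel_cycle }.
HB.instance Definition _ := [isSub for relZ_val].
HB.instance Definition _ := [Choice of relZ by <:].
HB.instance Definition _ := [SubChoice_isSubZmodule of relZ by <:].

Definition rel_boundary : pred relZ := fun z =>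
  `[< exists d e, [/\ chain_in L p.+1 d, chain_in L0 p e
                    & val z = bd d + e] >].

Lemma rel_boundary_closed : zmod_closed rel_boundary.
Proof.
split=> [|y z]; rewrite !unfold_in.
  apply/asboolP; exists 0, 0; split; rewrite /chain_in ?supported0 //.
  by rewrite !raddf0 addr0.
move=> /asboolP[d [e [dL eL0 Ey]]] /asboolP[d' [e' [d'L e'L0 Ez]]].
apply/asboolP; exists (d - d'), (e - e').
split; rewrite /chain_in ?supportedB //.
by rewrite !raddfB /= Ey Ez opprD addrACA.
Qed.

HB.instance Definition _ := GRing.isZmodClosed.Build relZ rel_boundary
  rel_boundary_closed.

Definition rel_homology : zmodType :=
  Quotient.quot (GRing.ZmodClosed.clone relZ rel_boundary _).

End Pair.
End Homology.

Section Dynamics.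
Variables (T : finType) (K : simplicialComplex T).
(* G is the coefficient group of homology and V the multivector field. *)
Variables (G : zmodType) (V : {set {set simplex K}}).
Implicit Types (s t : simplex K) (A B N S P E R : {set simplex K}).

Definition multivector A : Prop :=
  forall s t s', s \in A -> s' \in A -> face s t -> face t s' -> t \in A.

Definition multivector_field : Prop :=
  partition V [set: simplex K] /\ (forall A, A \in V -> multivector A).

Definition mvof s : {set simplex K} := pblock V s.

Definition critical A : Prop :=
  exists (p : nat) (h : rel_homology G (cl A) (mo A) p), h != 0.

Definition regular A : Prop := ~ critical A.

Definition F s : {set simplex K} := cl [set s] :|: mvof s.

Definition Fset A : {set simplex K} := \bigcup_(s in A) F s.

(* A path is a map on the integer interval [a, b]; it is represented by a map on
   int whose values outside [a, b] are irrelevant. *)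
Definition is_path (a b : int) (rho : int -> simplex K) : Prop :=
  forall i : int, a < i <= b -> rho i \in F (rho (i - 1)).

Definition solution (rho : int -> simplex K) : Prop :=
  forall i : int, rho i \in F (rho (i - 1)).

Definition essential (rho : int -> simplex K) : Prop :=
  forall i : int, regular (mvof (rho i)) ->
    exists im ip : int,
      [/\ im < i, i < ip, mvof (rho im) <> mvof (rho i)
        & mvof (rho i) <> mvof (rho ip)].

Definition Inv A : {set simplex K} :=
  [set s in A | `[< exists rho : int -> simplex K,
    [/\ solution rho, essential rho, forall i, rho i \in A & rho 0 = s] >]].

Definition invariant A : Prop := Inv A = A.

Definition isolated_by S N : Prop :=
  [/\ invariant S, S \subset N, is_closed N
    & forall (a b : int) (rho : int -> simplex K),
        a <= b -> is_path a b rho ->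
        (forall i, a <= i <= b -> rho i \in N) ->
        rho a \in S -> rho b \in S ->
        forall i, a <= i <= b -> rho i \in S].

Definition index_pair S N P E : Prop :=
  [/\ is_closed P, is_closed E, E \subset P & P \subset N] /\
  [/\ Fset P :&: N \subset P,
      Fset E :&: N \subset E,
      Fset (P :\: E) \subset N
    & S = Inv (P :\: E)].

Fixpoint collar (delta : nat) S : {set simplex K} :=
  if delta is d.+1 then
    collar d S :|:
    [set t | [exists s, face t s && [exists t' in collar d S, face t' s]]]
  else cl S.

Section FindR.
(* bdP and bdE stand for the boundaries of P and E. *)
Variables (S P E bdP bdE : {set simplex K}) (delta : nat).

Definition findR_accepts R B : Prop :=
  [/\ is_closed ((E :\: R) :\: B), B \subset E :\: R & regular B].

Definition findR_init : {set {set simplex K}} :=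
  [set B in V | [&& B \subset E :&: collar delta S,
                    B :&: bdE != set0 & B :&: bdP == set0]].

Definition findR_next B : {set {set simplex K}} :=
  [set mvof t | t in [set t in mo B | mvof t \subset collar delta S]].

(* findR_loop q R R' : started with queue q and accumulator R, the loop can
   terminate with accumulator R'.  The order (and possible repetitions) in which
   multivectors are pushed is left unspecified, hence the relation. *)
Inductive findR_loop :
    seq {set simplex K} -> {set simplex K} -> {set simplex K} -> Prop :=
| FindRStop R : findR_loop [::] R R
| FindRAccept B q new R R' :
    findR_accepts R B -> new =i findR_next B ->
    findR_loop (q ++ new) (R :|: B) R' -> findR_loop (B :: q) R R'
| FindRReject B q R R' :
    ~ findR_accepts R B -> findR_loop q R R' -> findR_loop (B :: q) R R'.

Definition findR_output R : Prop :=
  exists2 q, q =i findR_init & findR_loop q set0 R.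

Lemma findR_output_exists : multivector_field -> exists R, findR_output R.
Proof.
case=> /and3P[/eqP cV tV V0] _.
have inV t : mvof t \in V by rewrite pblock_mem // cV inE.
suff loop n q R : (#|E :\: R| < n)%N -> {subset q <= V} ->
    exists R', findR_loop q R R'.
  have [|B|R] := loop #|E :\: set0|.+1 (enum findR_init) set0 => //.
    by rewrite mem_enum inE => /andP[].
  by exists R, (enum findR_init) => // B; rewrite mem_enum.
elim: n q R => // n IHn; elim=> [|B q IHq] R ltn qV.
  by exists R; constructor.
have [acc|rej] := pselect (findR_accepts R B); last first.
  have [//|C Cq|R' run] := IHq R; first by rewrite qV // inE Cq orbT.
  by exists R'; apply: FindRReject.
have [|C|R' run] := IHn (q ++ enum (findR_next B)) (R :|: B).
- apply: leq_trans (ltn : _ <= n)%N; rewrite -setDDl proper_card //.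
  case: acc => _ BER _; rewrite properEneq subDset subsetUr andbT.
  have /set0Pn[t tB] : B != set0.
    by apply: contraNneq V0 => <-; rewrite qV // mem_head.
  apply/eqP => /setP/(_ t); rewrite in_setD tB /=.
  by rewrite (subsetP BER).
- rewrite mem_cat mem_enum => /orP[Cq|/imsetP[t _ ->]] //.
  by rewrite qV // inE Cq orbT.
- by exists R'; apply: FindRAccept run => // C; rewrite mem_enum.
Qed.

End FindR.
End Dynamics.

(* Main.v *)
Require Import Defs.
From mathcomp Require Import all_boot all_order all_algebra.
From mathcomp Require Import boolp.

Set Implicit Arguments.
Unset Strict Implicit.
Unset Printing Implicit Defensive.

Import Order.TTheory GRing.Theory Num.Theory.
Local Open Scope ring_scope.

(* By induction on the run it suffices to remove from E a single regular
   multivector B contained in E with E \ B closed.  A solution sitting in B can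
   leave B only through cl(B) \ B, which is contained in E \ B; hence a solution
   with values in P \ (E \ B) that meets B stays in B forever after.  As B is
   regular this is impossible for an essential solution, so the two differences
   P \ E and P \ (E \ B) have the same invariant part. *)

Section IndexPairs.
Variables (T : finType) (K : simplicialComplex T).
Implicit Types (s t : simplex K) (A B C N S P E R : {set simplex K}).

Lemma closed_cl1_sub A s : is_closed A -> s \in A -> cl [set s] \subset A.
Proof.
move=> /eqP Acl sA; apply/subsetP => t; rewrite -Acl !inE => /existsP[s'].
by rewrite inE => /andP[/eqP -> ts]; apply/existsP; exists s; rewrite sA.
Qed.

Variables (G : zmodType) (V : {set {set simplex K}}).

Lemma Inv_subset A C : A \subset C -> Inv G V A \subset Inv G V C.
Proof.
move=> /subsetP AC; apply/subsetP => s; rewrite !inE => /andP[sA /asboolP H].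
rewrite AC //=; apply/asboolP; case: H => rho [sol ess rhoA rho0].
by exists rho; split=> // i; apply: AC.
Qed.

Hypothesis mvV : multivector_field V.

Lemma mvof_eq B s : B \in V -> s \in B -> mvof V s = B.
Proof. by case: mvV => /and3P[_ tV _] _ BV sB; apply: def_pblock. Qed.

Lemma mem_mvof s : s \in mvof V s.
Proof. by case: mvV => /and3P[/eqP cV _ _] _; rewrite mem_pblock cV inE. Qed.

Lemma mvof_in s : mvof V s \in V.
Proof. by case: mvV => /and3P[/eqP cV _ _] _; rewrite pblock_mem // cV inE. Qed.

Lemma Inv_setDD P E B :
  B \in V -> is_closed E -> B \subset E -> regular G B ->
  Inv G V (P :\: (E :\: B)) \subset Inv G V (P :\: E).
Proof.
move=> BV Ecl /subsetP BE regB; apply/subsetP => s.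
rewrite inE => /andP[_ /asboolP[rho [sol ess rhoA rho0]]].
have stay i : rho i \in B -> rho (i + 1) \in B.
  move=> iB; have := sol (i + 1); rewrite addrK /F (mvof_eq BV iB).
  (* A step inside the multivector remains in [B] at once. A step to a face lands in the closed set
     [E], and since [rho] avoids [E :\: B], it lands in [B]. *)
  case/setUP => // /(subsetP (closed_cl1_sub Ecl (BE _ iB))) E1.
  by have := rhoA (i + 1); rewrite !inE E1 andbT negbK => /andP[].
have stayn i (n : nat) : rho i \in B -> rho (i + n%:Z) \in B.
  move=> iB; elim: n => [|n IHn]; first by rewrite addr0.
  by rewrite -addn1 PoszD addrA stay.
have avoid i : rho i \notin B.
  apply/negP => iB; have mvi := mvof_eq BV iB.
  (* Only the later time [ip] gives a contradiction: [rho] might well have entered [B] from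
     outside. *)
  have [|_ [ip [_ ltip _ []]]] := ess i; first by rewrite mvi.
  have ge0 : 0 <= ip - i by rewrite subr_ge0 ltW.
  have := stayn i `|ip - i|%N iB; rewrite gez0_abs // subrKC => ipB.
  by rewrite mvi (mvof_eq BV ipB).
have rhoPE i : rho i \in P :\: E.
  by have := rhoA i; rewrite !inE (negbTE (avoid i)).
rewrite inE -{1}rho0 rhoPE /=; apply/asboolP.
by exists rho.
Qed.

Lemma index_pair_setD S N P E B :
  index_pair G V S N P E -> B \in V -> is_closed (E :\: B) ->
  B \subset E -> regular G B -> index_pair G V S N P (E :\: B).
Proof.
move=> [[Pcl Ecl EP PN] [FP FE FPE ->]] BV EBcl BE regB.
split; split=> //; first exact: subset_trans (subsetDl _ _) EP.
- apply/subsetP => t /setIP[/bigcupP[s sEB tF] tN].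
  case/setUP: tF => [|ts]; first exact/subsetP/closed_cl1_sub.
  case/setDP: sEB => sE sB; rewrite inE; apply/andP; split.
    (* Multivectors are disjoint: if [t] were in [B], then [s], lying in the same multivector, would
       be too. *)
    apply: contra sB => tB; rewrite -(mvof_eq BV tB) (mvof_eq (mvof_in s) ts).
    exact: mem_mvof.
  apply: (subsetP FE); rewrite inE tN andbT.
  by apply/bigcupP; exists s; rewrite // inE ts orbT.
(* The points gained by the difference are those of [P :&: B]; there the closure part of [F] stays
   in [P] and the multivector part is [B] itself, so both lie in [N]. *)
- apply/bigcupsP => s; rewrite setDDr => /setUP[sPE|/setIP[sP sB]].
    by apply: subset_trans FPE; apply: bigcup_sup.
  rewrite /F (mvof_eq BV sB) subUset; apply/andP.
  split; first by apply: subset_trans PN; apply: closed_cl1_sub.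
  exact: subset_trans BE (subset_trans EP PN).
- apply/eqP; rewrite eqEsubset Inv_setDD // andbT.
  by apply: Inv_subset; apply/setDS/subsetDl.
Qed.

(** The acceptance test concerns [E :\: R], so an accepted [B] is an instance of [index_pair_setD]
    with [E :\: R] for [E]; a rejection changes nothing. The queue stays within [V] because appended
    entries have the form [mvof V t]. *)
Lemma index_pair_findR_loop S N P E delta q R R' :
  findR_loop G V S E delta q R R' -> {subset q <= V} ->
  index_pair G V S N P (E :\: R) -> index_pair G V S N P (E :\: R').
Proof.
elim=> {q R R'} [//|B q new R R' [? ? ?] newE _ IH|B q R R' _ _ IH] qV.
  move=> IP; apply: IH => [C|].
    rewrite mem_cat => /orP[Cq|]; first by rewrite qV // inE Cq orbT.
    by rewrite newE => /imsetP[t _ ->]; apply: mvof_in.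
  by rewrite -setDDl; apply: index_pair_setD => //; rewrite qV ?mem_head.
by apply: IH => C Cq; rewrite qV // inE Cq orbT.
Qed.

End IndexPairs.

Theorem theorem18 (T : finType) (K : simplicialComplex T) (G : zmodType)
    (V : {set {set simplex K}}) (N S P E : {set simplex K})
    (bdP bdE : {set simplex K}) (delta : nat) (R : {set simplex K}) :
  multivector_field V ->
  is_closed N ->
  isolated_by G V S N ->
  index_pair G V S N P E ->
  findR_output G V S E bdP bdE delta R ->
  index_pair G V S N P (E :\: R).
Proof.
move=> mvV _ _ IP [q qE run]; apply: (index_pair_findR_loop mvV run).
  by move=> B; rewrite qE inE => /andP[].
by rewrite setD0.
Qed.
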